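(* Let $f:[\theta_1,\theta_2]\to\mathbb{R}$ be a differentiable function on $(\theta_1,\theta_2)$ with $\theta_1<\theta_2$ and $f'\in L_1[\theta_1,\theta_2]$. If $|f'|^q$ is a convex function, then the following inequality for Atangana-Baleanu fractional integral operators holds: $$\Bigg|\frac{2(\theta_2-\theta_1)^{\alpha}+(1-\alpha)2^{\alpha+1}\Gamma(\alpha)}{(\theta_2-\theta_1)^{\alpha+1}}\left[f(\theta_1)+f(\theta_2)+2f\left(\tfrac{\theta_1+\theta_2}{2}\right)\right]$$ $$-\frac{2^{\alpha+1}B(\alpha)\Gamma(\alpha)}{(\theta_2-\theta_1)^{\alpha+1}}\left[\left({}^{AB}I^{\alpha}_{\frac{\theta_1+\theta_2}{2}}f\right)(\theta_1)+\left({}^{AB}_{\theta_1}I^{\alpha}f\right)\left(\tfrac{\theta_1+\theta_2}{2}\right)+\left({}^{AB}_{\frac{\theta_1+\theta_2}{2}}I^{\alpha}f\right)(\theta_2)+\left({}^{AB}I^{\alpha}_{\theta_2}f\right)\left(\tfrac{\theta_1+\theta_2}{2}\right)\right]\Bigg|$$ $$\le\left(\frac{1}{\alpha+1}\right)^{1-\frac1q}\Bigg[\left(\frac{\alpha+3}{2(\alpha+1)(\alpha+2)}|f'(\theta_1)|^q+\frac{1}{2(\alpha+2)}|f'(\theta_2)|^q\right)^{\frac1q}$$ $$+\left(\frac{2\alpha+3}{2(\alpha+1)(\alpha+2)}|f'(\theta_1)|^q+\frac{1}{2(\alpha+1)(\alpha+2)}|f'(\theta_2)|^q\right)^{\frac1q}$$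 $$+\left(\frac{2\alpha+3}{2(\alpha+1)(\alpha+2)}|f'(\theta_2)|^q+\frac{1}{2(\alpha+1)(\alpha+2)}|f'(\theta_1)|^q\right)^{\frac1q}$$ $$+\left(\frac{\alpha+3}{2(\alpha+1)(\alpha+2)}|f'(\theta_2)|^q+\frac{1}{2(\alpha+2)}|f'(\theta_1)|^q\right)^{\frac1q}\Bigg],$$ where $\alpha\in[0,1]$, $q\ge1$ and $B(\alpha)$ is a normalization function.
   Context: $\Gamma$ is the Gamma function and $B(\alpha)$ is the normalization function appearing in the Atangana-Baleanu operators. The left and right Atangana-Baleanu fractional integrals of order $\alpha\in[0,1]$ with base points $a$ and $b$ are, respectively, $$\left({}^{AB}_{a}I^{\alpha}f\right)(t)=\frac{1-\alpha}{B(\alpha)}f(t)+\frac{\alpha}{B(\alpha)\Gamma(\alpha)}\int_a^t f(y)(t-y)^{\alpha-1}\,dy,$$ $$\left({}^{AB}I^{\alpha}_{b}f\right)(t)=\frac{1-\alpha}{B(\alpha)}f(t)+\frac{\alpha}{B(\alpha)\Gamma(\alpha)}\int_t^b f(y)(y-t)^{\alpha-1}\,dy.$$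
   Formalization: α ranges over (0,1] because Γ(α) has a pole at α=0; B(α)≠0 is assumed; f is also assumed to have one-sided derivatives f'(θ1), f'(θ2) at the endpoints, since these values occur in the bound and the claim fails for f discontinuous at an endpoint. *)

(* Defs.v *)
From HB Require Import structures.
From mathcomp Require Import all_boot all_order all_algebra.
From mathcomp Require Import all_classical all_reals all_analysis.
Set Implicit Arguments.
Unset Strict Implicit.
Unset Printing Implicit Defensive.
Import Order.TTheory GRing.Theory Num.Theory.
Import numFieldNormedType.Exports.
Local Open Scope classical_set_scope.
Local Open Scope ring_scope.

(* Euler's integral.  It diverges for x <= 0, where [Rintegral] returns a dummy
   value: this is the Gamma function for 0 < x only. *)
Definition Gamma {R : realType} (x : R) : R :=
  \int[lebesgue_measure]_(t in `]0, +oo[) (t `^ (x - 1) * expR (- t)).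

(* [f'] is the derivative of [f : [a, b] -> R]: two-sided in the interior and
   one-sided at the endpoints.  Values of [f] and [f'] outside [a, b] are
   irrelevant. *)
Definition is_derivative_cc {R : realType} (a b : R) (f f' : R -> R) : Prop :=
  [/\ forall x : R, x \in `]a, b[ -> is_derive x (1 : R) f (f' x),
      h^-1 * (f (a + h) - f a) @[h --> (0 : R)^'+] --> f' a
    & h^-1 * (f (b + h) - f b) @[h --> (0 : R)^'-] --> f' b].

(* Left Atangana-Baleanu integral of order [alpha] with base point [a]. *)
Definition ABleft {R : realType} (B : R -> R) (alpha a : R) (f : R -> R)
    (t : R) : R :=
  (1 - alpha) / B alpha * f t +
  alpha / (B alpha * Gamma alpha) *
    \int[lebesgue_measure]_(y in `[a, t]) (f y * (t - y) `^ (alpha - 1)).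

(* Right Atangana-Baleanu integral of order [alpha] with base point [b]. *)
Definition ABright {R : realType} (B : R -> R) (alpha b : R) (f : R -> R)
    (t : R) : R :=
  (1 - alpha) / B alpha * f t +
  alpha / (B alpha * Gamma alpha) *
    \int[lebesgue_measure]_(y in `[t, b]) (f y * (y - t) `^ (alpha - 1)).

(* Main.v *)
Require Import Defs.
From HB Require Import structures.
From mathcomp Require Import all_boot all_order all_algebra.
From mathcomp Require Import all_classical all_reals all_analysis.
From mathcomp Require Import measurable_realfun.
From mathcomp Require Import ring lra.
Set Implicit Arguments.
Unset Strict Implicit.
Unset Printing Implicit Defensive.
Import Order.TTheory GRing.Theory Num.Theory.
Import numFieldNormedType.Exports.
Local Open Scope classical_set_scope.
Local Open Scope ring_scope.

(** Put h := (th2 - th1) / 2.  The local terms of the four Atangana-Baleanu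
    integrals cancel the (1 - alpha) Gamma(alpha) part of the first coefficient,
    and what is left, multiplied by h^(alpha + 1), is a sum of four terms
      h^alpha f(d) - alpha int f(x) |x - e|^(alpha - 1) dx,
    one for each half interval and each choice of the endpoint e at which the
    kernel is singular, d being the other endpoint of that half.  The right-hand
    side has one summand for each of these terms.

    Usually each term is integrated by parts into a weighted integral of f',
    which is then estimated by Hoelder's inequality.  Here both steps are
    replaced by pointwise comparisons.  Since alpha int |x - e|^(alpha - 1) dx =
    h^alpha, each term equals alpha int (f(d) - f(x)) |x - e|^(alpha - 1) dx, so
    it is enough to dominate |f(d) - f(x)|.

    With s := |x - e| / h, convexity bounds |f'(x)|^q by an affine function
    P + Q s ([convex_function_chord]).  The tangent to the q-th power at a
    suitable point turns this into an affine bound p + r s for |f'(x)| itself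
    ([affine_majorant_of_power]); with the tangent point chosen where the
    power-mean inequality is sharp, this loses nothing, because
      int_0^1 s^alpha (p + r s) ds = p / (alpha + 1) + r / (alpha + 2)
    is then exactly the summand of the claim.  By the mean value theorem,
    |f(d) - f(x)| is at most the increment of a quadratic polynomial
    ([mean_value_domination]), and integrating that polynomial against the
    kernel takes only the primitives of powers
    ([left_singular_deviation], [right_singular_deviation]).

    Dividing by Gamma(alpha) needs 0 < Gamma(alpha), which is
    [Gamma_gt0]. *)

(** * Integrals with an endpoint singularity *)

Lemma itvoo_bigcup (R : realType) (a b : R) : a < b ->
  `]a, b[%classic =
  \bigcup_n `[a + (b - a) / n.+3%:R, b - (b - a) / n.+3%:R]%classic.
Proof.
move=> ab; have d0 : 0 < b - a by rewrite subr_gt0.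
apply/seteqP; split => [x /=|x [n _] /=]; last first.
  have n0 : 0 < (b - a) / n.+3%:R by rewrite divr_gt0.
  by rewrite !in_itv/=; set e := _ / _ in n0 *; lra.
rewrite in_itv/= => /andP[ax xb].
pose e := Num.min (x - a) (b - x).
have e0 : 0 < e by rewrite lt_min !subr_gt0 ax xb.
have [n hn] : exists n : nat, (b - a) / e < n%:R.
  by exists (Num.bound ((b - a) / e)); rewrite archi_boundP// divr_ge0// ltW.
exists n => //=; rewrite in_itv/=.
have ne : (b - a) / n.+3%:R <= e.
  rewrite ler_pdivrMr// mulrC -ler_pdivrMr// (le_trans (ltW hn))//.
  by rewrite ler_nat -addn3 leq_addr.
have ea : e <= x - a by rewrite ge_min lexx.
have eb : e <= b - x by rewrite ge_min lexx orbT.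
move: ne ea eb; move: (_ / _) e {e0 hn} => u e ne ea eb.
by apply/andP; split; lra.
Qed.

(** The integrand may blow up at an end, as a power with negative exponent
    does: apply the fundamental theorem of calculus on compact subintervals
    exhausting the open interval, pass to the limit by monotone convergence on
    the left-hand side and by continuity of [F] on the right. *)
Lemma ge0_FTC_oo (R : realType) (F w : R -> R) (a b : R) : a < b ->
  continuous F ->
  (forall x, x \in `]a, b[ -> is_derive x (1 : R) F (w x)) ->
  {in `]a, b[, continuous w} ->
  (forall x, x \in `]a, b[ -> 0 <= w x) ->
  (\int[lebesgue_measure]_(x in `]a, b[) (w x)%:E = (F b - F a)%:E)%E.
Proof.
move=> ab cF dF cw w0; have d0 : 0 < b - a by rewrite subr_gt0.
pose e (n : nat) := (b - a) / n.+3%:R.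
have e0 n : 0 < e n by rewrite divr_gt0.
have e2 n : 2 * e n < b - a.
  rewrite /e mulrCA gtr_pMr// ltr_pdivrMr// mul1r.
  by rewrite ltr_nat.
have sub n x : x \in `[a + e n, b - e n] -> x \in `]a, b[.
  by move: (e0 n); rewrite !in_itv/=; lra.
have mw : measurable_fun `]a, b[ w.
  by apply: open_continuous_measurable_fun => //; exact/in_continuous_mksetP.
have subS n : `[a + e n, b - e n]%classic `<=` `]a, b[%classic.
  by move=> x /=; exact: sub.
have eN m n : (m <= n)%N -> e n <= e m.
  move=> mn; rewrite /e ler_pM2l// lef_pV2 ?posrE//.
  by rewrite ler_nat !ltnS.
have lim1 : (\int[lebesgue_measure]_(x in `[(a + e n)%R, (b - e n)%R])
      (w x)%:E)%E
    @[n --> \oo] --> (\int[lebesgue_measure]_(x in `]a, b[) (w x)%:E)%E.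
  rewrite (itvoo_bigcup ab); apply: ge0_nondecreasing_set_cvg_integral.
  - move=> m n mn; apply/subsetPset => x /=; move: (eN _ _ mn).
    by rewrite !in_itv/=; lra.
  - by move=> n; exact: measurable_itv.
  - by move=> n; apply/measurable_EFinP; apply: measurable_funS mw.
  - by move=> n x /= /sub xab; rewrite lee_fin w0.
have lim2 : (F (b - e n) - F (a + e n))%:E @[n --> \oo] --> (F b - F a)%:E.
  have eC : e n @[n --> \oo] --> 0.
    rewrite -[0](mulr0 (b - a)); apply: cvgM; first exact: cvg_cst.
    exact: (cvg_comp (addn 2) harmonic (cvg_addnl 2) cvg_harmonic).
  apply: cvg_EFin; first exact: nearW.
  apply: cvgB.
    apply: continuous_cvg; first exact: cF.
    by rewrite -[X in _ --> X]subr0; apply: cvgB => //; exact: cvg_cst.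
  apply: continuous_cvg; first exact: cF.
  by rewrite -[X in _ --> X]addr0; apply: cvgD => //; exact: cvg_cst.
apply: (cvg_unique _ lim1); first exact: ereal_hausdorff.
apply: cvg_trans lim2; apply: near_eq_cvg; apply: nearW => n.
rewrite (@continuous_FTC2 _ w F)//.
- by move: (e2 n); lra.
- by apply: continuous_subspace_itv => x /sub; exact: cw.
- split.
  + by move=> x /subset_itv_oo_cc /sub /dF[].
  + exact: cvg_at_right_filter (cF _).
  + exact: cvg_at_left_filter (cF _).
- move=> x /subset_itv_oo_cc /sub /dF dFx.
  by rewrite derive1E derive_val.
Qed.

Lemma ge0_FTC_integrable (R : realType) (F w : R -> R) (a b : R) : a < b ->
  continuous F ->
  (forall x, x \in `]a, b[ -> is_derive x (1 : R) F (w x)) ->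
  {in `]a, b[, continuous w} ->
  (forall x, x \in `]a, b[ -> 0 <= w x) ->
  (@lebesgue_measure R).-integrable `]a, b[ (EFin \o w).
Proof.
move=> ab cF dF cw w0; apply/integrableP; split.
  apply/measurable_EFinP; apply: open_continuous_measurable_fun => //.
  exact/in_continuous_mksetP.
rewrite (_ : (\int[_]_(x in _) _ = (F b - F a)%:E)%E) ?ltry//.
rewrite -(ge0_FTC_oo ab cF dF cw w0); apply: eq_integral => x.
by rewrite inE/= => /w0 ?; rewrite ger0_norm.
Qed.

(** Integrate [C - f] against the weight [w]; the primitives [V] of [w] and [Phi]
    of [phi * w] give the integrals in closed form even where [w] is unbounded. *)
Lemma weighted_deviation (R : realType) (f w phi V Phi : R -> R) (a b C : R) :
  a < b -> {within `[a, b], continuous f} ->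
  continuous V -> (forall x, x \in `]a, b[ -> is_derive x (1 : R) V (w x)) ->
  {in `]a, b[, continuous w} -> (forall x, x \in `]a, b[ -> 0 <= w x) ->
  continuous Phi ->
  (forall x, x \in `]a, b[ -> is_derive x (1 : R) Phi (phi x * w x)) ->
  continuous phi ->
  (forall x, x \in `]a, b[ -> `|C - f x| <= phi x) ->
  `|C * (V b - V a) - \int[lebesgue_measure]_(x in `[a, b]) (f x * w x)|
    <= Phi b - Phi a.
Proof.
move=> ab cf cV dV cw w0 cPhi dPhi cphi Cf.
pose mu := @lebesgue_measure R.
have mI : measurable (`]a, b[%classic : set (measurableTypeR R)) by [].
have iw := ge0_FTC_integrable ab cV dV cw w0.
have cphiw : {in `]a, b[, continuous (fun x => phi x * w x)}.
  by move=> x xab; apply: cvgM; [exact: cphi|exact: cw].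
have phi0 x : x \in `]a, b[ -> 0 <= phi x.
  by move=> xab; apply: le_trans (Cf _ xab).
have phiw0 x : x \in `]a, b[ -> 0 <= phi x * w x.
  by move=> xab; rewrite mulr_ge0 ?w0 ?phi0.
have iphiw := ge0_FTC_integrable ab cPhi dPhi cphiw phiw0.
have cfoo : {in `]a, b[, continuous f}.
  by have [] := (continuous_within_itvP f ab).1 cf.
have mf : measurable_fun `]a, b[ f.
  by apply: open_continuous_measurable_fun => //; exact/in_continuous_mksetP.
have mw : measurable_fun `]a, b[ w.
  by apply: open_continuous_measurable_fun => //; exact/in_continuous_mksetP.
have iCfw : mu.-integrable `]a, b[ (EFin \o (fun x => (C - f x) * w x)).
  apply: le_integrable iphiw => //.
    apply/measurable_EFinP; apply: measurable_funM => //.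
    exact: measurable_funB.
  move=> x /= xab; rewrite lee_fin normrM [leRHS]normrM.
  by rewrite ler_wpM2r// (ger0_norm (phi0 _ xab)) Cf.
have iCw : mu.-integrable `]a, b[ (EFin \o (fun x => C * w x)).
  have := integrableZl mI C iw; by apply: eq_integrable => // x _.
have ifw : mu.-integrable `]a, b[ (EFin \o (fun x => f x * w x)).
  have := integrableB mI iCw iCfw; apply: eq_integrable => // x _ /=.
  by rewrite -EFinB; congr EFin; ring.
have -> : \int[mu]_(x in `[a, b]) (f x * w x) =
    \int[mu]_(x in `]a, b[) (f x * w x).
  by rewrite /Rintegral integral_itv_bndoo//; exact: measurable_int ifw.
have Vw : V b - V a = \int[mu]_(x in `]a, b[) w x.
  by rewrite /Rintegral (ge0_FTC_oo ab cV dV cw w0).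
have -> : Phi b - Phi a = \int[mu]_(x in `]a, b[) (phi x * w x).
  by rewrite /Rintegral (ge0_FTC_oo ab cPhi dPhi cphiw phiw0).
rewrite Vw -RintegralZl// -RintegralB//.
under eq_Rintegral do rewrite -mulrBl.
apply: le_trans (le_normr_Rintegral mI iCfw) _.
apply: le_Rintegral => //; first exact: (integrable_norm iCfw).
move=> x /= xab; rewrite normrM (ger0_norm (w0 _ xab)).
by rewrite ler_wpM2r ?w0 ?Cf.
Qed.

(** * Comparison of increments *)

Lemma derive_ge0_le (R : realType) (g g' : R -> R) (x y : R) : x <= y ->
  {within `[x, y], continuous g} ->
  (forall z, z \in `]x, y[ -> is_derive z (1 : R) g (g' z)) ->
  (forall z, z \in `]x, y[ -> 0 <= g' z) -> g x <= g y.
Proof.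
rewrite le_eqVlt => /predU1P[->//|xy] cg dg g0.
have [c cxy gE] := MVT xy dg cg.
by rewrite -subr_ge0 gE mulr_ge0 ?g0// subr_ge0 ltW.
Qed.

(** Both [G + f] and [G - f] are nondecreasing. *)
Lemma mean_value_domination (R : realType) (f f' G G' : R -> R) (a b x y : R) :
  {within `[a, b], continuous f} -> {within `[a, b], continuous G} ->
  (forall z, z \in `]a, b[ -> is_derive z (1 : R) f (f' z)) ->
  (forall z, z \in `]a, b[ -> is_derive z (1 : R) G (G' z)) ->
  (forall z, z \in `]a, b[ -> `|f' z| <= G' z) ->
  a <= x -> x <= y -> y <= b -> `|f y - f x| <= G y - G x.
Proof.
move=> cf cG df dG fG ax xy yb.
have sub z : z \in `]x, y[ -> z \in `]a, b[ by rewrite !in_itv/=; lra.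
have subc : `[x, y]%classic `<=` `[a, b]%classic.
  by move=> z; rewrite /= !in_itv/=; lra.
have cf' : {within `[x, y], continuous f} by exact: continuous_subspaceW cf.
have cG' : {within `[x, y], continuous G} by exact: continuous_subspaceW cG.
have cD : {within `[x, y], continuous (fun z => G z + f z)}.
  by move=> z; apply: continuousD; [exact: cG'|exact: cf'].
have cB : {within `[x, y], continuous (fun z => G z - f z)}.
  by move=> z; apply: continuousB; [exact: cG'|exact: cf'].
have dD z : z \in `]x, y[ ->
    is_derive z (1 : R) (fun z => G z + f z) (G' z + f' z).
  by move=> /sub zab; exact: is_deriveD (dG _ zab) (df _ zab).
have dB z : z \in `]x, y[ ->
    is_derive z (1 : R) (fun z => G z - f z) (G' z - f' z).
  by move=> /sub zab; exact: is_deriveB (dG _ zab) (df _ zab).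
have Df : G x + f x <= G y + f y.
  apply: (@derive_ge0_le _ (fun z => G z + f z) (fun z => G' z + f' z)
    _ _ xy cD dD).
  by move=> z /sub /fG; rewrite ler_norml => /andP[]; lra.
have Bf : G x - f x <= G y - f y.
  apply: (@derive_ge0_le _ (fun z => G z - f z) (fun z => G' z - f' z)
    _ _ xy cB dB).
  by move=> z /sub /fG; rewrite ler_norml => /andP[]; lra.
by rewrite ler_norml; apply/andP; split; lra.
Qed.

(** * The power-mean inequality in tangent form *)

(** The graph of the [q]-th power lies above its tangent at 1; for [1 < q] this is
    Young's inequality with one factor equal to 1. *)
Lemma power_tangent (R : realType) (q w : R) : 1 <= q -> 0 <= w ->
  w <= w `^ q / q + (1 - q^-1).
Proof.
move=> q1 w0; move: q1; rewrite le_eqVlt => /predU1P[<-|q1].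
  by rewrite invr1 mulr1 powRr1// subrr addr0.
have q0 : 0 < q by lra.
have iq : q^-1 < 1 by rewrite invf_lt1.
have := @conjugate_powR R w 1 q (1 - q^-1)^-1 w0 ler01 q0.
rewrite invr_gt0 subr_gt0 => /(_ iq); rewrite invrK subrKC => /(_ erefl).
by rewrite powR1 mulr1 mul1r.
Qed.

(** Rescaling [power_tangent] by [k] bounds [w] by an affine function of [w `^ q],
    hence of [s].  Take for [k ^ q] the mean [c] of [P + Q * s] on [0, 1] for the
    probability density [(alpha + 1) * s `^ alpha]: the mean of the resulting
    affine bound is then [k] itself, as in the equality case of the power-mean
    inequality. *)
Lemma affine_majorant_of_power (R : realType) (alpha q P Q : R) :
  0 < alpha -> 1 <= q -> 0 <= P -> 0 <= P + Q ->
  exists p r : R,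
    (forall s w, 0 <= w -> w `^ q <= P + Q * s -> w <= p + r * s) /\
    p / (alpha + 1) + r / (alpha + 2) =
    (1 / (alpha + 1)) `^ (1 - 1 / q) *
    (P / (alpha + 1) + Q / (alpha + 2)) `^ (1 / q).
Proof.
move=> a0 q1 P0 PQ0; rewrite !div1r; have q0 : 0 < q by lra.
have qN0 : q != 0 by rewrite gt_eqF.
have a1 : 0 < alpha + 1 by lra. have a2 : 0 < alpha + 2 by lra.
set I := P / _ + Q / _.
have IE : I = P / ((alpha + 1) * (alpha + 2)) + (P + Q) / (alpha + 2).
  by rewrite /I; field; rewrite !gt_eqF.
have I1 : 0 <= P / ((alpha + 1) * (alpha + 2)).
  by rewrite divr_ge0// mulr_ge0 ?ltW.
have I2 : 0 <= (P + Q) / (alpha + 2) by rewrite divr_ge0 // ltW.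
have I0 : 0 <= I by rewrite IE addr_ge0.
(* If the mean vanishes then so do [P] and [Q], and no tangent point is
   available, but the majorant 0 is. *)
move: (I0); rewrite le_eqVlt => /predU1P[I00|Igt0].
  have /eqP : P / ((alpha + 1) * (alpha + 2)) = 0.
    by apply/eqP; rewrite eq_le I1 andbT I00 IE lerDl.
  have d1 : ((alpha + 1) * (alpha + 2))^-1 != 0.
    by rewrite invr_neq0// gt_eqF// mulr_gt0.
  have d2 : (alpha + 2)^-1 != 0 by rewrite invr_neq0// gt_eqF.
  rewrite mulf_eq0 (negPf d1) orbF => /eqP PE.
  have /eqP : (P + Q) / (alpha + 2) = 0.
    by apply/eqP; rewrite eq_le I2 andbT I00 IE lerDr.
  rewrite mulf_eq0 (negPf d2) orbF PE add0r => /eqP QE.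
  exists 0, 0; split.
    move=> s w w0; rewrite QE !mul0r addr0 => wq.
    have /eqP : w `^ q = 0 by apply/eqP; rewrite eq_le wq powR_ge0.
    by rewrite powR_eq0 => /andP[/eqP->].
  by rewrite -I00 !mul0r addr0 powR0 ?invr_eq0// mulr0.
pose c := (alpha + 1) * I; have c0 : 0 < c by rewrite mulr_gt0.
pose k := c `^ q^-1; have k0 : 0 < k by rewrite powR_gt0.
have kq : k `^ q = c by rewrite /k -powRrM mulVf// powRr1// ltW.
exists (k * (P / (c * q) + (1 - q^-1))), (k * (Q / (c * q))); split.
  move=> s w w0 wPQ.
  have wk0 : 0 <= w / k by rewrite divr_ge0// ltW.
  have wkq : (w / k) `^ q = w `^ q / c.
    rewrite powRM ?invr_ge0 ?(ltW k0)// -(powR_inv1 (ltW k0)) powRAC kq.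
    by rewrite powR_inv1// ltW.
  have := power_tangent q1 wk0; rewrite wkq ler_pdivrMr// mulrC.
  move=> /le_trans; apply.
  have -> : k * (P / (c * q) + (1 - q^-1)) + k * (Q / (c * q)) * s =
     k * ((P + Q * s) / c / q + (1 - q^-1)).
    by field; rewrite qN0 gt_eqF.
  rewrite ler_wpM2l ?(ltW k0)// lerD2r ler_pM2r ?invr_gt0//.
  by rewrite ler_pM2r ?invr_gt0.
have -> : k * (P / (c * q) + (1 - q^-1)) / (alpha + 1)
    + k * (Q / (c * q)) / (alpha + 2) =
  k / (alpha + 1) * ((alpha + 1) * I / c / q + (1 - q^-1)).
  by rewrite /I; field; rewrite qN0 !gt_eqF.
rewrite -/c divff ?gt_eqF// div1r subrKC mulr1 /k /c powRM ?(ltW a1)//.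
rewrite mulrAC; congr (_ * _).
rewrite -{2}(powRr1 (ltW a1)) -powRB; last by rewrite (gt_eqF a1) implybT.
by rewrite -[in RHS]powR_inv1 ?(ltW a1)// -powRrM; congr (_ `^ _); ring.
Qed.

(** * Primitives of powers and of quadratic polynomials times a power *)

(** The absolute value makes the power continuous on the whole line: on negative
    reals, where the logarithm vanishes, the power without it is 1. *)
Lemma continuous_norm_powR (R : realType) (g : R) : 0 < g ->
  continuous (fun t : R => `|t| `^ g).
Proof.
move=> g0 x; have [->|x0] := eqVneq x 0.
  apply/cvgrPdist_lt => e e0; near=> t.
  rewrite normr0 powR0 ?gt_eqF// sub0r normrN ger0_norm ?powR_ge0//.
  rewrite -[ltRHS](powRr1 (ltW e0)) -(mulVf (lt0r_neq0 g0)) powRrM.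
  rewrite gt0_ltr_powR ?nnegrE ?powR_ge0//.
  near: t; have e1 : 0 < e `^ g^-1 by rewrite powR_gt0.
  exact: (@pseudometric_normed_Zmodule.nbhs0_lt _ R^o _ e1).
apply: (@continuous_cvg _ _ _ _ _ (fun t : R => `|t|) (fun t : R => t `^ g)).
  apply/differentiable_continuous/derivable1_diffP.
  by apply: derivable_powR; rewrite in_itv/= andbT normr_gt0.
exact: norm_continuous.
Unshelve. all: by end_near. Qed.

Lemma is_derive_norm_powR (R : realType) (g t : R) : 0 < t ->
  is_derive t (1 : R) (fun t : R => `|t| `^ g) (g * t `^ (g - 1)).
Proof.
move=> t0; apply: near_eq_is_derive (is_derive1_powR g t0).
have: \forall u \near t, 0 < u by exact: lt_nbhsr.
by apply: filterS => u u0; rewrite gtr0_norm.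
Qed.

Lemma is_derive_reflect (R : realType) (F : R -> R) (b x df : R) :
  is_derive (b - x) (1 : R) F df ->
  is_derive x (1 : R) (fun x => - F (b - x)) df.
Proof.
move=> dF.
have dg : is_derive x (1 : R) (fun x => b - x) (-1).
  have := is_deriveB (is_derive_cst b x 1) (is_derive_id x (1 : R)).
  by rewrite sub0r.
have := is_deriveN (@is_derive1_comp R F _ x _ _ dF dg).
by rewrite mulrN1 opprK.
Qed.

Lemma is_derive_translate (R : realType) (F : R -> R) (a x df : R) :
  is_derive (x - a) (1 : R) F df -> is_derive x (1 : R) (fun x => F (x - a)) df.
Proof.
move=> dF.
have dg : is_derive x (1 : R) (fun x => x - a) 1.
  have := is_deriveB (is_derive_id x (1 : R)) (is_derive_cst a x 1).
  by rewrite subr0.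
by have := @is_derive1_comp R F _ x _ _ dF dg; rewrite mulr1.
Qed.

Definition powR_primitive (R : realType) (g t : R) : R := `|t| `^ g / g.

Lemma powR_primitive0 (R : realType) (g : R) : 0 < g -> powR_primitive g 0 = 0.
Proof. by move=> g0; rewrite /powR_primitive normr0 powR0 ?gt_eqF// mul0r. Qed.

Lemma powR_primitiveE (R : realType) (g t : R) : 0 < t ->
  powR_primitive g t = t `^ g / g.
Proof. by move=> t0; rewrite /powR_primitive gtr0_norm. Qed.

Lemma continuous_powR_primitive (R : realType) (g : R) : 0 < g ->
  continuous (@powR_primitive R g).
Proof.
by move=> g0 x; apply: cvgM; [exact: continuous_norm_powR|exact: cvg_cst].
Qed.

Lemma is_derive_powR_primitive (R : realType) (g t : R) : 0 < g -> 0 < t ->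
  is_derive t (1 : R) (powR_primitive g) (t `^ (g - 1)).
Proof.
move=> g0 t0; have dg := is_derive_norm_powR g t0.
have := is_deriveZ g^-1 dg.
rewrite /powR_primitive (_ : _ \*: _ = fun t => `|t| `^ g / g); last first.
  by apply/funext => u; rewrite mulrC.
by rewrite [_ *: _]mulrA mulVf ?gt_eqF// mul1r.
Qed.

(** The primitive, vanishing at 0, of
    [(p * (h - t) + r / (2 * h) * (h ^+ 2 - t ^+ 2)) * t `^ (alpha - 1)], whose
    first factor is the integral of [p + r * (u / h)] over [u] from [t] to [h]. *)
Definition moment_primitive (R : realType) (h alpha p r t : R) : R :=
  (p * h + r / (2 * h) * h ^+ 2) * powR_primitive alpha t
  - p * powR_primitive (alpha + 1) t
  - r / (2 * h) * powR_primitive (alpha + 2) t.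

Lemma continuous_moment_primitive (R : realType) (h alpha p r : R) :
  0 < alpha -> continuous (moment_primitive h alpha p r).
Proof.
move=> a0 x.
have c c0 g : 0 < g -> (fun t : R => c0 * powR_primitive g t) t @[t --> x]
    --> c0 * powR_primitive g x.
  by move=> g0; apply: cvgM; [exact: cvg_cst|exact: continuous_powR_primitive].
by apply: cvgB; [apply: cvgB|]; apply: c; lra.
Qed.

Lemma is_derive_moment_primitive (R : realType) (h alpha p r t : R) :
  0 < alpha -> 0 < t ->
  is_derive t (1 : R) (moment_primitive h alpha p r)
    ((p * (h - t) + r / (2 * h) * (h ^+ 2 - t ^+ 2)) * t `^ (alpha - 1)).
Proof.
move=> a0 t0.
have a1 : 0 < alpha + 1 by lra.
have a2 : 0 < alpha + 2 by lra.
have d0 := is_derive_powR_primitive a0 t0.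
have d1 := is_derive_powR_primitive a1 t0.
have d2 := is_derive_powR_primitive a2 t0.
have E1 : t `^ (alpha + 1 - 1) = t * t `^ (alpha - 1).
  by rewrite mulr_powRB1// ?(ltW t0)//; congr (_ `^ _); ring.
have E2 : t `^ (alpha + 2 - 1) = t ^+ 2 * t `^ (alpha - 1).
  rewrite expr2 -mulrA mulr_powRB1// ?(ltW t0)//.
  have -> : alpha + 2 - 1 = alpha + 1 by ring.
  by rewrite -(mulr_powRB1 (ltW t0) a1); congr (_ * _ `^ _); ring.
have D := is_deriveB (is_deriveB
  (is_deriveZ (p * h + r / (2 * h) * h ^+ 2) d0) (is_deriveZ p d1))
  (is_deriveZ (r / (2 * h)) d2).
apply: (@is_derive_eq _ _ _ _ _ _ _ _ D).
by rewrite E1 E2 /GRing.scale/=; ring.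
Qed.

Lemma moment_primitive0 (R : realType) (h alpha p r : R) :
  0 < alpha -> moment_primitive h alpha p r 0 = 0.
Proof.
move=> a0; rewrite /moment_primitive !powR_primitive0; lra.
Qed.

Lemma moment_primitive_full (R : realType) (h alpha p r : R) :
  0 < h -> 0 < alpha ->
  moment_primitive h alpha p r h =
  h `^ (alpha + 1) / alpha * (p / (alpha + 1) + r / (alpha + 2)).
Proof.
move=> h0 a0; rewrite /moment_primitive !powR_primitiveE//.
have hN0 : h != 0 by rewrite gt_eqF.
have E1 : h `^ (alpha + 1) = h `^ alpha * h.
  by rewrite powRD ?hN0 ?implybT// powRr1// ltW.
have E2 : h `^ (alpha + 2) = h `^ alpha * h ^+ 2.
  by rewrite powRD ?hN0 ?implybT// powR_mulrn// ltW.
rewrite E1 E2; field.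
by rewrite hN0 !gt_eqF//; lra.
Qed.

(** * One half interval, kernel singular at one endpoint *)

(** The bound is [h * (p + r * s)] integrated against [s `^ alpha], up to the factor
    [h `^ alpha / alpha]: by Fubini, weighting the increment of [f] from [x] to [b]
    with the kernel amounts to weighting its derivative with the primitive of the
    kernel.  The quadratic polynomial [G] makes this an explicit computation. *)
Lemma left_singular_deviation (R : realType) (f f' : R -> R)
    (a b alpha p r : R) :
  a < b -> 0 < alpha -> {within `[a, b], continuous f} ->
  (forall x, x \in `]a, b[ -> is_derive x (1 : R) f (f' x)) ->
  (forall x, x \in `]a, b[ -> `|f' x| <= p + r * ((x - a) / (b - a))) ->
  `|f b * ((b - a) `^ alpha / alpha)
    - \int[lebesgue_measure]_(x in `[a, b]) (f x * (x - a) `^ (alpha - 1))|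
  <= (b - a) `^ (alpha + 1) / alpha * (p / (alpha + 1) + r / (alpha + 2)).
Proof.
move=> ab a0 cf df f'_le; set h := b - a.
have h0 : 0 < h by rewrite subr_gt0.
pose G x := p * (x - a) + r / (2 * h) * (x - a) ^+ 2.
have dG x : is_derive x (1 : R) G (p + r * ((x - a) / h)).
  have d1 : is_derive x (1 : R) (fun x => x - a) 1.
    by have := is_deriveB (is_derive_id x (1 : R)) (is_derive_cst a x 1);
      rewrite subr0.
  apply: (@is_derive_eq _ _ _ _ _ _ _ _
    (is_deriveD (is_deriveZ p d1) (is_deriveZ (r / (2 * h)) (is_deriveX 2 d1)))).
  by rewrite /GRing.scale/= expr1; field; rewrite gt_eqF.
have cG : {within `[a, b], continuous G}.
  by apply: derivable_within_continuous => x _; have [] := dG x.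
have fG x : x \in `]a, b[ -> `|f b - f x| <=
    p * (h - (x - a)) + r / (2 * h) * (h ^+ 2 - (x - a) ^+ 2).
  rewrite in_itv/= => /andP[ax xb].
  have := mean_value_domination cf cG df (fun z _ => dG z) f'_le
    (ltW ax) (ltW xb) (lexx b).
  by rewrite /G -/h => /le_trans; apply; lra.
have := @weighted_deviation R f (fun x => (x - a) `^ (alpha - 1))
  (fun x => p * (h - (x - a)) + r / (2 * h) * (h ^+ 2 - (x - a) ^+ 2))
  (fun x => powR_primitive alpha (x - a))
  (fun x => moment_primitive h alpha p r (x - a)) a b (f b) ab cf.
rewrite -/h subrr (moment_primitive0 _ _ _ a0) subr0.
rewrite (moment_primitive_full _ _ h0 a0) (powR_primitive0 a0) subr0.
rewrite (powR_primitiveE _ h0); apply.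
- move=> x; apply: (@continuous_comp _ _ _ (fun x => x - a)).
    by apply: cvgB; [exact: cvg_id|exact: cvg_cst].
  exact: continuous_powR_primitive.
- move=> x; rewrite in_itv/= => /andP[ax _].
  apply: is_derive_translate; apply: is_derive_powR_primitive => //.
  by rewrite subr_gt0.
- move=> x; rewrite in_itv/= => /andP[ax _].
  apply/differentiable_continuous/derivable1_diffP.
  apply: ex_derive; apply: (is_derive_translate (F := fun t => t `^ (alpha - 1))).
  by apply: is_derive1_powR; rewrite subr_gt0.
- by move=> x _; exact: powR_ge0.
- move=> x; apply: (@continuous_comp _ _ _ (fun x => x - a)).
    by apply: cvgB; [exact: cvg_id|exact: cvg_cst].
  exact: continuous_moment_primitive.
- move=> x; rewrite in_itv/= => /andP[ax _].
  apply: is_derive_translate; apply: is_derive_moment_primitive => //.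
  by rewrite subr_gt0.
- move=> x; apply: differentiable_continuous; exact: ex_diff.
- exact: fG.
Qed.

(** Mirror image of [left_singular_deviation]: distances are measured from [b], so
    the primitives in the distance change sign as functions of [x]. *)
Lemma right_singular_deviation (R : realType) (f f' : R -> R)
    (a b alpha p r : R) :
  a < b -> 0 < alpha -> {within `[a, b], continuous f} ->
  (forall x, x \in `]a, b[ -> is_derive x (1 : R) f (f' x)) ->
  (forall x, x \in `]a, b[ -> `|f' x| <= p + r * ((b - x) / (b - a))) ->
  `|f a * ((b - a) `^ alpha / alpha)
    - \int[lebesgue_measure]_(x in `[a, b]) (f x * (b - x) `^ (alpha - 1))|
  <= (b - a) `^ (alpha + 1) / alpha * (p / (alpha + 1) + r / (alpha + 2)).
Proof.
move=> ab a0 cf df f'_le; set h := b - a.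
have h0 : 0 < h by rewrite subr_gt0.
pose G x := - (p * (b - x) + r / (2 * h) * (b - x) ^+ 2).
have dG x : is_derive x (1 : R) G (p + r * ((b - x) / h)).
  pose P (t : R) := p * t + r / (2 * h) * t ^+ 2.
  suff dP : is_derive (b - x) (1 : R) P (p + r * ((b - x) / h)).
    exact: is_derive_reflect dP.
  have d1 := is_derive_id (b - x) (1 : R).
  apply: (@is_derive_eq _ _ _ _ _ _ _ _
    (is_deriveD (is_deriveZ p d1) (is_deriveZ (r / (2 * h)) (is_deriveX 2 d1)))).
  by rewrite /GRing.scale/= expr1; field; rewrite gt_eqF.
have cG : {within `[a, b], continuous G}.
  by apply: derivable_within_continuous => x _; have [] := dG x.
have fG x : x \in `]a, b[ -> `|f a - f x| <=
    p * (h - (b - x)) + r / (2 * h) * (h ^+ 2 - (b - x) ^+ 2).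
  rewrite in_itv/= => /andP[ax xb].
  have := mean_value_domination cf cG df (fun z _ => dG z) f'_le
    (lexx a) (ltW ax) (ltW xb).
  by rewrite distrC /G -/h => /le_trans; apply; lra.
have := @weighted_deviation R f (fun x => (b - x) `^ (alpha - 1))
  (fun x => p * (h - (b - x)) + r / (2 * h) * (h ^+ 2 - (b - x) ^+ 2))
  (fun x => - powR_primitive alpha (b - x))
  (fun x => - moment_primitive h alpha p r (b - x)) a b (f a) ab cf.
rewrite -/h subrr (moment_primitive0 _ _ _ a0).
rewrite (moment_primitive_full _ _ h0 a0) (powR_primitive0 a0).
rewrite (powR_primitiveE _ h0) !opprK !oppr0 !add0r; apply.
- move=> x; apply: cvgN; apply: (@continuous_comp _ _ _ (fun x => b - x)).
    by apply: cvgB; [exact: cvg_cst|exact: cvg_id].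
  exact: continuous_powR_primitive.
- move=> x; rewrite in_itv/= => /andP[_ xb].
  apply: is_derive_reflect; apply: is_derive_powR_primitive => //.
  by rewrite subr_gt0.
- move=> x; rewrite in_itv/= => /andP[_ xb].
  apply: (@continuous_comp _ _ _ (fun x => b - x) (fun t => t `^ (alpha - 1))).
    by apply: cvgB; [exact: cvg_cst|exact: cvg_id].
  apply/differentiable_continuous/derivable1_diffP.
  by apply: derivable_powR; rewrite in_itv/= andbT subr_gt0.
- by move=> x _; exact: powR_ge0.
- move=> x; apply: cvgN; apply: (@continuous_comp _ _ _ (fun x => b - x)).
    by apply: cvgB; [exact: cvg_cst|exact: cvg_id].
  exact: continuous_moment_primitive.
- move=> x; rewrite in_itv/= => /andP[_ xb].
  apply: is_derive_reflect; apply: is_derive_moment_primitive => //.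
  by rewrite subr_gt0.
- move=> x; apply: differentiable_continuous; exact: ex_diff.
- exact: fG.
Qed.

(** * Positivity of the Gamma integral *)

(** Positivity includes finiteness, since the real-valued integral of a function
    with infinite integral is 0.  The integrand is at most [t `^ (alpha - 1)] on
    ]0, 1] and at most [expR (- t)] beyond 1, and at least [expR (- 1)] on
    ]0, 1]. *)
Lemma Gamma_gt0 (R : realType) (alpha : R) : 0 < alpha <= 1 -> 0 < Gamma alpha.
Proof.
move=> /andP[a0 a1]; rewrite /Gamma.
pose mu := @lebesgue_measure R.
pose g (t : R) := t `^ (alpha - 1) * expR (- t).
have ge0 t : 0 <= g t by rewrite mulr_ge0 ?powR_ge0 ?expR_ge0.
have mg D : measurable_fun (D : set (measurableTypeR R)) (EFin \o g).
  apply/measurable_EFinP; apply: measurable_funTS; apply: measurable_funM => //.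
  by apply: measurableT_comp => //; exact: measurableT_comp.
have pow_le1 t : 0 < t -> t <= 1 -> 1 <= t `^ (alpha - 1).
  by move=> t0 t1; rewrite -[leLHS](powRr0 t) ger_powR ?t0//; lra.
have split01 : `]0, +oo[%classic =
    `]0, 1]%classic `|` `]1, +oo[%classic :> set R.
  by rewrite -itv_bndbnd_setU// bnd_simp.
have fin1 : (\int[mu]_(t in `]0%R, 1%R]) (g t)%:E < +oo)%E.
  have : (\int[mu]_(t in `]0%R, 1%R]) (t `^ (alpha - 1))%:E < +oo)%E.
    have -> : (\int[mu]_(t in `]0%R, 1%R]) (t `^ (alpha - 1))%:E =
        \int[mu]_(t in `]0%R, 1%R[) (t `^ (alpha - 1))%:E)%E.
      apply: integral_itv_bndoo; apply/measurable_EFinP.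
      exact: measurable_funTS.
    suff -> : (\int[mu]_(t in `]0%R, 1%R[) (t `^ (alpha - 1))%:E =
        (powR_primitive alpha 1 - powR_primitive alpha 0)%:E)%E by rewrite ltry.
    apply: ge0_FTC_oo => //.
    - exact: continuous_powR_primitive.
    - move=> x; rewrite in_itv/= => /andP[x0 _].
      exact: is_derive_powR_primitive.
    - move=> x; rewrite in_itv/= => /andP[x0 _].
      apply/differentiable_continuous/derivable1_diffP.
      by apply: derivable_powR; rewrite in_itv/= x0.
    - by move=> x _; exact: powR_ge0.
  move=> powfin; apply: le_lt_trans powfin; apply: ge0_le_integral => //.
  - by move=> t _; rewrite lee_fin.
  - by apply/measurable_EFinP; exact: measurable_funTS.
  - move=> t /=; rewrite in_itv/= => /andP[t0 _].
    by rewrite lee_fin ler_piMr ?powR_ge0// expR_le1 oppr_le0 ltW.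
have fin2 : (\int[mu]_(t in `]1%R, +oo[) (g t)%:E < +oo)%E.
  have : (\int[mu]_(t in `[0%R, +oo[) (expR (- t))%:E < +oo)%E.
    rewrite (@ge0_continuous_FTC2y R (fun t => expR (- t))
      (fun t => - expR (- t)) 0 0).
    - by rewrite -EFinD ltry.
    - by move=> x _; exact: expR_ge0.
    - apply: continuous_subspaceT => x.
      apply: (@continuous_comp _ _ _ -%R expR); last exact: continuous_expR.
      exact: continuousN.
    - rewrite -oppr0; apply: cvgN; exact: cvgr_expR.
    - by move=> x _; exact: ex_derive.
    - apply: cvg_at_right_filter; apply: cvgN.
      apply: (@continuous_comp _ _ _ -%R expR); last exact: continuous_expR.
      exact: continuousN.
    - by move=> x _; rewrite derive1E derive_val; ring.
  move=> expfin; apply: le_lt_trans expfin.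
  apply: (@le_trans _ _ (\int[mu]_(t in `]1%R, +oo[) (expR (- t))%:E)%E).
    apply: ge0_le_integral => //.
    - by move=> t _; rewrite lee_fin.
    - apply/measurable_EFinP; apply: measurable_funTS.
      by apply: measurableT_comp => //; exact: measurableT_comp.
    - move=> t /=; rewrite in_itv/= => /andP[t1 _]; rewrite lee_fin.
      by rewrite ler_piMl ?expR_ge0// -[leRHS](powRr0 t) ler_powR ?(ltW t1)//; lra.
  apply: ge0_subset_integral => //.
  - apply/measurable_EFinP; apply: measurable_funTS.
    by apply: measurableT_comp => //; exact: measurableT_comp.
  - by move=> t /=; rewrite !in_itv/= !andbT => /ltW; apply: le_trans.
have pos1 : ((expR (- 1))%:E <= \int[mu]_(t in `]0%R, 1%R]) (g t)%:E)%E.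
  have -> : ((expR (- 1))%:E =
      \int[mu]_(t in `]0%R, 1%R]) (expR (- 1))%:E :> \bar R)%E.
    rewrite integral_cst//= lebesgue_measure_itv/= lte_fin ltr01.
    by rewrite -EFinB subr0 mule1.
  apply: ge0_le_integral => //.
  move=> t /=; rewrite in_itv/= => /andP[t0 t1]; rewrite lee_fin.
  by rewrite -[leLHS]mul1r ler_pM ?expR_ge0 ?pow_le1// ler_expR lerN2.
rewrite /Rintegral -/g fine_gt0// split01 ge0_integral_setU//=.
- apply/andP; split; last exact: lte_add_pinfty.
  have I20 : (0 <= \int[mu]_(t in `]1%R, +oo[) (g t)%:E)%E.
    by apply: integral_ge0 => t _; rewrite lee_fin.
  apply: lt_le_trans (leeDl _ I20).
  by apply: lt_le_trans pos1; rewrite lte_fin expR_gt0.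
- by move=> t _; rewrite lee_fin ge0.
- apply/disj_setPS => y [/=]; rewrite 2!in_itv/= => /andP[_ y1] /andP[].
  by rewrite ltNge y1.
Qed.

(** * Differentiability on a closed interval and convexity *)

Lemma cvg_of_difference_quotient (R : realType) (F : set_system R)
    (FF : Filter F) (f : R -> R) (a l : R) :
  h @[h --> F] --> (0 : R) -> (\forall h \near F, h != 0) ->
  h^-1 * (f (a + h) - f a) @[h --> F] --> l -> f (a + h) @[h --> F] --> f a.
Proof.
move=> F0 FN0 dq.
have : f a + h * (h^-1 * (f (a + h) - f a)) @[h --> F] --> f a + 0 * l.
  by apply: cvgD; [exact: cvg_cst|exact: cvgM].
rewrite mul0r addr0; apply: cvg_trans; apply: near_eq_cvg.
by apply: filterS FN0 => h hN0; rewrite mulVKf// subrKC.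
Qed.

Lemma is_derivative_cc_continuous (R : realType) (a b : R) (f f' : R -> R) :
  a < b -> is_derivative_cc a b f f' -> {within `[a, b], continuous f}.
Proof.
move=> ab [df fa fb]; apply/(continuous_within_itvP _ ab); split.
- move=> x /df[dfx _].
  by apply/differentiable_continuous/derivable1_diffP; exact: dfx.
- have H : f (a + h) @[h --> (0 : R)^'+] --> f a.
    apply: cvg_of_difference_quotient fa.
      by apply: cvg_at_right_filter; exact: cvg_id.
    by near=> h; rewrite gt_eqF//; near: h; exact: nbhs_right_gt.
  apply/cvgrPdist_lt => e e0; apply/nbhs_right0P.
  by move/cvgrPdist_lt : H; apply.
- have H : f (b + h) @[h --> (0 : R)^'-] --> f b.
    apply: cvg_of_difference_quotient fb.
      by apply: cvg_at_left_filter; exact: cvg_id.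
    by near=> h; rewrite lt_eqF//; near: h; exact: nbhs_left_lt.
  apply/cvgrPdist_lt => e e0; apply/nbhs_left0P.
  move/cvg_at_leftNP : H; rewrite oppr0 => /cvgrPdist_lt.
  by apply.
Unshelve. all: by end_near. Qed.

Lemma convex_function_chord (R : realType) (g : R -> R) (a b x : R) :
  a < b -> convex_function (`[a, b] : set R) g -> x \in `]a, b[ ->
  g x <= ((b - x) * g a + (x - a) * g b) / (b - a).
Proof.
move=> ab cg; rewrite in_itv/= => /andP[ax xb].
have h0 : 0 < b - a by rewrite subr_gt0.
have t0 : 0 <= (b - x) / (b - a) by rewrite divr_ge0// ?ltW// subr_gt0.
have t1 : (b - x) / (b - a) <= 1 by rewrite ler_pdivrMr// mul1r; lra.
have ha : a \in (`[a, b]%classic : set R) by rewrite inE/= in_itv/= lexx ltW.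
have hb : b \in (`[a, b]%classic : set R) by rewrite inE/= in_itv/= lexx ltW.
have := cg (Itv01 t0 t1) a b ha hb.
rewrite !convRE/= /unstable.onem.
rewrite [X in g X <= _ -> _](_ : _ = x); last first.
  change ((b - x) / (b - a) * a + (1 - (b - x) / (b - a)) * b = x).
  by field; rewrite gt_eqF.
move/le_trans; apply; rewrite le_eqVlt; apply/orP; left; apply/eqP.
by field; rewrite gt_eqF.
Qed.

(** * The weighted power-mean estimate on a half interval *)

Lemma left_singular_power_mean (R : realType) (f f' : R -> R)
    (a b alpha q P Q : R) :
  a < b -> 0 < alpha -> 1 <= q -> 0 <= P -> 0 <= P + Q ->
  {within `[a, b], continuous f} ->
  (forall x, x \in `]a, b[ -> is_derive x (1 : R) f (f' x)) ->
  (forall x, x \in `]a, b[ -> `|f' x| `^ q <= P + Q * ((x - a) / (b - a))) ->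
  `|(b - a) `^ alpha * f b - alpha *
    \int[lebesgue_measure]_(x in `[a, b]) (f x * (x - a) `^ (alpha - 1))|
  <= (b - a) `^ (alpha + 1) * ((1 / (alpha + 1)) `^ (1 - 1 / q) *
      (P / (alpha + 1) + Q / (alpha + 2)) `^ (1 / q)).
Proof.
move=> ab a0 q1 P0 PQ0 cf df f'q.
have [p [r [pr <-]]] := affine_majorant_of_power a0 q1 P0 PQ0.
have := @left_singular_deviation R f f' a b alpha p r ab a0 cf df
  (fun x xab => pr _ _ (normr_ge0 _) (f'q x xab)).
set I := Rintegral _ _ _.
have aN0 : alpha != 0 by rewrite gt_eqF.
have -> : f b * ((b - a) `^ alpha / alpha) - I =
  ((b - a) `^ alpha * f b - alpha * I) / alpha by field.
by rewrite normrM normfV (gtr0_norm a0) [_ / alpha * _]mulrAC ler_pM2r ?invr_gt0.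
Qed.

Lemma right_singular_power_mean (R : realType) (f f' : R -> R)
    (a b alpha q P Q : R) :
  a < b -> 0 < alpha -> 1 <= q -> 0 <= P -> 0 <= P + Q ->
  {within `[a, b], continuous f} ->
  (forall x, x \in `]a, b[ -> is_derive x (1 : R) f (f' x)) ->
  (forall x, x \in `]a, b[ -> `|f' x| `^ q <= P + Q * ((b - x) / (b - a))) ->
  `|(b - a) `^ alpha * f a - alpha *
    \int[lebesgue_measure]_(x in `[a, b]) (f x * (b - x) `^ (alpha - 1))|
  <= (b - a) `^ (alpha + 1) * ((1 / (alpha + 1)) `^ (1 - 1 / q) *
      (P / (alpha + 1) + Q / (alpha + 2)) `^ (1 / q)).
Proof.
move=> ab a0 q1 P0 PQ0 cf df f'q.
have [p [r [pr <-]]] := affine_majorant_of_power a0 q1 P0 PQ0.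
have := @right_singular_deviation R f f' a b alpha p r ab a0 cf df
  (fun x xab => pr _ _ (normr_ge0 _) (f'q x xab)).
set I := Rintegral _ _ _.
have aN0 : alpha != 0 by rewrite gt_eqF.
have -> : f a * ((b - a) `^ alpha / alpha) - I =
  ((b - a) `^ alpha * f a - alpha * I) / alpha by field.
by rewrite normrM normfV (gtr0_norm a0) [_ / alpha * _]mulrAC ler_pM2r ?invr_gt0.
Qed.

Theorem theorem2p3 (R : realType) (th1 th2 alpha q : R) (B f f' : R -> R)
    (hth : th1 < th2)
    (halpha : 0 < alpha <= 1)
    (hq : 1 <= q)
    (hB : B alpha != 0)
    (hf : is_derivative_cc th1 th2 f f')
    (hf'L1 : (@lebesgue_measure R).-integrable `[th1, th2] (EFin \o f'))
    (hconv : convex_function (`[th1, th2] : set R)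
               (fun x : R => `|f' x| `^ q)) :
  let m := (th1 + th2) / 2 in
  `| (2 * (th2 - th1) `^ alpha + (1 - alpha) * 2 `^ (alpha + 1) * Gamma alpha)
       / (th2 - th1) `^ (alpha + 1) * (f th1 + f th2 + 2 * f m)
     - 2 `^ (alpha + 1) * B alpha * Gamma alpha / (th2 - th1) `^ (alpha + 1)
       * (ABright B alpha m f th1 + ABleft B alpha th1 f m
          + ABleft B alpha m f th2 + ABright B alpha th2 f m) |
  <= (1 / (alpha + 1)) `^ (1 - 1 / q) *
     ( ((alpha + 3) / (2 * (alpha + 1) * (alpha + 2)) * `|f' th1| `^ q
        + 1 / (2 * (alpha + 2)) * `|f' th2| `^ q) `^ (1 / q)
     + ((2 * alpha + 3) / (2 * (alpha + 1) * (alpha + 2)) * `|f' th1| `^ q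
        + 1 / (2 * (alpha + 1) * (alpha + 2)) * `|f' th2| `^ q) `^ (1 / q)
     + ((2 * alpha + 3) / (2 * (alpha + 1) * (alpha + 2)) * `|f' th2| `^ q
        + 1 / (2 * (alpha + 1) * (alpha + 2)) * `|f' th1| `^ q) `^ (1 / q)
     + ((alpha + 3) / (2 * (alpha + 1) * (alpha + 2)) * `|f' th2| `^ q
        + 1 / (2 * (alpha + 2)) * `|f' th1| `^ q) `^ (1 / q) ).
Proof.
cbv zeta; set m := (th1 + th2) / 2; have /andP[a0 a1] := halpha.
have G0 : 0 < Gamma alpha by exact: Gamma_gt0.
pose h := (th2 - th1) / 2.
have h0 : 0 < h by rewrite /h; lra.
have h1 : m - th1 = h by rewrite /m /h; field.
have h2 : th2 - m = h by rewrite /m /h; field.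
have m1 : th1 < m by rewrite -subr_gt0 h1.
have m2 : m < th2 by rewrite -subr_gt0 h2.
have [df _ _] := hf.
have cf := is_derivative_cc_continuous hth hf.
have cf1 : {within `[th1, m], continuous f}.
  apply: continuous_subspaceW cf => x; rewrite /= !in_itv/=.
  by move=> /andP[-> xm]; exact: le_trans xm (ltW m2).
have cf2 : {within `[m, th2], continuous f}.
  apply: continuous_subspaceW cf => x; rewrite /= !in_itv/=.
  by move=> /andP[mx ->]; rewrite (le_trans (ltW m1) mx).
have sub1 x : x \in `]th1, m[ -> x \in `]th1, th2[.
  by rewrite !in_itv/= => /andP[-> xm]; exact: lt_trans xm m2.
have sub2 x : x \in `]m, th2[ -> x \in `]th1, th2[.
  by rewrite !in_itv/= => /andP[mx ->]; rewrite (lt_trans m1 mx).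
have df1 x (hx : x \in `]th1, m[) := df x (sub1 x hx).
have df2 x (hx : x \in `]m, th2[) := df x (sub2 x hx).
set A := `|f' th1| `^ q; set D := `|f' th2| `^ q.
have A0 : 0 <= A by exact: powR_ge0.
have D0 : 0 <= D by exact: powR_ge0.
have chord x : x \in `]th1, th2[ ->
    `|f' x| `^ q <= A * ((th2 - x) / (2 * h)) + D * ((x - th1) / (2 * h)).
  move=> hx; have := convex_function_chord hth hconv hx.
  rewrite -/A -/D => /le_trans; apply; rewrite le_eqVlt; apply/orP; left.
  by apply/eqP; rewrite /h; field; rewrite gt_eqF// subr_gt0.
have hN0 : h != 0 by rewrite gt_eqF.
have e1 : th2 = th1 + 2 * h by rewrite /h; field.
have em : m = th1 + h by rewrite -h1; ring.
(* The chord over [th1, th2], written in the relative distance of [x] to the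
   singular endpoint of each term. *)
have Q1 : forall x, x \in `]th1, m[ ->
    `|f' x| `^ q <= A + (D - A) / 2 * ((x - th1) / (m - th1)).
  move=> x /sub1 /chord /le_trans; apply; rewrite le_eqVlt; apply/orP; left.
  by apply/eqP; rewrite h1 e1; field.
have Q2 : forall x, x \in `]th1, m[ ->
    `|f' x| `^ q <= (A + D) / 2 + (A - D) / 2 * ((m - x) / (m - th1)).
  move=> x /sub1 /chord /le_trans; apply; rewrite le_eqVlt; apply/orP; left.
  by apply/eqP; rewrite h1 e1 em; field.
have Q3 : forall x, x \in `]m, th2[ ->
    `|f' x| `^ q <= (A + D) / 2 + (D - A) / 2 * ((x - m) / (th2 - m)).
  move=> x /sub2 /chord /le_trans; apply; rewrite le_eqVlt; apply/orP; left.
  by apply/eqP; rewrite h2 e1 em; field.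
have Q4 : forall x, x \in `]m, th2[ ->
    `|f' x| `^ q <= D + (A - D) / 2 * ((th2 - x) / (th2 - m)).
  move=> x /sub2 /chord /le_trans; apply; rewrite le_eqVlt; apply/orP; left.
  by apply/eqP; rewrite h2 e1; field.
have s1 : 0 <= A + (D - A) / 2 by lra.
have s2 : 0 <= (A + D) / 2 by lra.
have s2A : 0 <= (A + D) / 2 + (A - D) / 2 by lra.
have s2D : 0 <= (A + D) / 2 + (D - A) / 2 by lra.
have s4 : 0 <= D + (A - D) / 2 by lra.
have := left_singular_power_mean m1 a0 hq A0 s1 cf1 df1 Q1.
have := right_singular_power_mean m1 a0 hq s2 s2A cf1 df1 Q2.
have := left_singular_power_mean m2 a0 hq s2 s2D cf2 df2 Q3.
have := right_singular_power_mean m2 a0 hq D0 s4 cf2 df2 Q4.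
rewrite h1 h2 /ABleft /ABright.
set I4 := Rintegral _ _ _; set I3 := Rintegral _ _ _.
set I2 := Rintegral _ _ _; set I1 := Rintegral _ _ _.
move=> B4 B3 B2 B1.
have a1N0 : alpha + 1 != 0 by rewrite gt_eqF// addr_gt0.
have a2N0 : alpha + 2 != 0 by rewrite gt_eqF// addr_gt0.
have E1 : A / (alpha + 1) + (D - A) / 2 / (alpha + 2) =
  (alpha + 3) / (2 * (alpha + 1) * (alpha + 2)) * A + 1 / (2 * (alpha + 2)) * D.
  by field; rewrite a1N0 a2N0.
have E2 : (A + D) / 2 / (alpha + 1) + (A - D) / 2 / (alpha + 2) =
  (2 * alpha + 3) / (2 * (alpha + 1) * (alpha + 2)) * A
    + 1 / (2 * (alpha + 1) * (alpha + 2)) * D.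
  by field; rewrite a1N0 a2N0.
have E3 : (A + D) / 2 / (alpha + 1) + (D - A) / 2 / (alpha + 2) =
  (2 * alpha + 3) / (2 * (alpha + 1) * (alpha + 2)) * D
    + 1 / (2 * (alpha + 1) * (alpha + 2)) * A.
  by field; rewrite a1N0 a2N0.
have E4 : D / (alpha + 1) + (A - D) / 2 / (alpha + 2) =
  (alpha + 3) / (2 * (alpha + 1) * (alpha + 2)) * D + 1 / (2 * (alpha + 2)) * A.
  by field; rewrite a1N0 a2N0.
rewrite E1 in B1; rewrite E2 in B2; rewrite E3 in B3; rewrite E4 in B4.
move: B1 B2 B3 B4.
set T1 := ((alpha + 3) / _ * A + _) `^ _.
set T2 := ((2 * alpha + 3) / _ * A + _) `^ _.
set T3 := ((2 * alpha + 3) / _ * D + _) `^ _.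
set T4 := ((alpha + 3) / _ * D + _) `^ _.
set c := (_ / _) `^ _ => B1 B2 B3 B4.
have L0 : 0 < th2 - th1 by rewrite subr_gt0.
have Lh : th2 - th1 = 2 * h by rewrite /h; field.
have p20 : (2 : R) `^ alpha != 0 by rewrite gt_eqF// powR_gt0.
have ph0 : 0 < h `^ alpha by rewrite powR_gt0.
have ph1 : 0 < h `^ (alpha + 1) by rewrite powR_gt0.
have P2 : (2 : R) `^ (alpha + 1) = 2 `^ alpha * 2.
  by rewrite powRD ?powRr1// pnatr_eq0 implybT.
have PH : h `^ (alpha + 1) = h `^ alpha * h.
  by rewrite powRD ?hN0 ?implybT// powRr1// ltW.
have PL g : (th2 - th1) `^ g = 2 `^ g * h `^ g.
  by rewrite Lh powRM// ltW.
(* The local terms of the four operators cancel against the part of the first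
   coefficient with factor [Gamma alpha], then [B alpha], [Gamma alpha] and the
   powers of 2 drop out. *)
set lhs := (X in `|X|).
have -> : lhs =
  ((h `^ alpha * f m - alpha * I1) + (h `^ alpha * f th1 - alpha * I2)
  + (h `^ alpha * f th2 - alpha * I3) + (h `^ alpha * f m - alpha * I4))
  / h `^ (alpha + 1).
  rewrite /lhs !PL P2 PH; field.
  by rewrite hN0 hB p20 !gt_eqF.
rewrite normrM normfV (gtr0_norm ph1) ler_pdivrMr//.
have -> : c * (T1 + T2 + T3 + T4) * h `^ (alpha + 1) =
    h `^ (alpha + 1) * (c * T1) + h `^ (alpha + 1) * (c * T2)
    + h `^ (alpha + 1) * (c * T3) + h `^ (alpha + 1) * (c * T4) by ring.
apply: le_trans (ler_normD _ _) (lerD _ B4).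
apply: le_trans (ler_normD _ _) (lerD _ B3).
exact: le_trans (ler_normD _ _) (lerD B1 B2).
Qed.
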